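(* Let $\tfrac12<\alpha<1$ and let $(X,d)$ be an $\mathrm{SRA}(\alpha)$ free metric space. Then there exists $\lambda_0=\lambda_0(\alpha,X)>0$ such that any bounded rough $\lambda$-self-contracting curve in $(X,d)$ with $\lambda\in[-1,\lambda_0)$ is rectifiable.
   Context: For $0\le\alpha\le 1$, a metric space $(Y,d)$ satisfies the $\mathrm{SRA}(\alpha)$ condition if $d(x,y)\le\max\{d(x,z)+\alpha d(z,y),\ \alpha d(x,z)+d(z,y)\}$ for all $x,y,z\in Y$. For $0\le\alpha<1$, a metric space $(X,d)$ is $\mathrm{SRA}(\alpha)$ free if there exists $N\in\mathbb N$ such that every subset $F\subset X$ which (with the restricted metric) satisfies the $\mathrm{SRA}(\alpha)$ condition has at most $N$ elements. For $-1\le\lambda\le 1$, a rough $\lambda$-self-contracting curve in $(X,d)$ is a map $\gamma:I\to X$, $I=[0,T]$ a compact interval, such that for all $t_1\le t_2\le t_3$ in $I$, $d(\gamma(t_2),\gamma(t_3))\le d(\gamma(t_1),\gamma(t_3))+\lambda\, d(\gamma(t_1),\gamma(t_2))$. Curves are not assumed continuous, and are assumed to be injective. A curve is bounded if its image is bounded. The length of $\gamma$ is the supremum of $\sum_{i=1}^{m-1}d(\gamma(t_i),\gamma(t_{i+1}))$ over all finite sequences $t_1<\cdots<t_m$ in $I$, and $\gamma$ is rectifiable if its length is finite. *)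

(* Defs.v *)
From mathcomp Require Export all_boot all_order all_algebra.
From mathcomp Require Export all_classical all_reals ereal topology.

Set Implicit Arguments.
Unset Strict Implicit.
Unset Printing Implicit Defensive.

Import Order.TTheory GRing.Theory Num.Theory.

Local Open Scope classical_set_scope.
Local Open Scope ring_scope.

(* The SRA(alpha) condition for a subset Y of X with the restricted metric. *)
Definition SRA (R : realType) (X : metricType R) (alpha : R) (Y : set X) : Prop :=
  forall x y z : X, Y x -> Y y -> Y z ->
    mdist x y <= Num.max (mdist x z + alpha * mdist z y)
                         (alpha * mdist x z + mdist z y).

Definition SRA_free (R : realType) (X : metricType R) (alpha : R) : Prop :=
  exists N : nat, forall F : set X, SRA alpha F -> (F #<= `I_N)%card.

(* A curve [0, T] -> X is a function on the whole line, of which only the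
   values on [0, T] are ever used. Curves are injective by convention, and
   the parameter lambda ranges over [-1, 1]. *)
Record rough_self_contracting (R : realType) (X : metricType R)
    (lambda T : R) (gamma : R -> X) : Prop := RoughSelfContracting {
  rsc_param : -1 <= lambda <= 1 ;
  rsc_injective : {in `[0, T] &, injective gamma} ;
  rsc_le : forall t1 t2 t3 : R,
    t1 \in `[0, T] -> t2 \in `[0, T] -> t3 \in `[0, T] ->
    t1 <= t2 -> t2 <= t3 ->
    mdist (gamma t2) (gamma t3) <=
      mdist (gamma t1) (gamma t3) + lambda * mdist (gamma t1) (gamma t2)
}.

Definition metric_bounded (R : realType) (X : metricType R) (A : set X) : Prop :=
  exists M : R, forall x y : X, A x -> A y -> mdist x y <= M.

Definition bounded_curve (R : realType) (X : metricType R) (T : R)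
    (gamma : R -> X) : Prop :=
  metric_bounded (gamma @` [set` `[0, T]]).

Definition polygonal_length (R : realType) (X : metricType R)
    (gamma : R -> X) (s : seq R) : R :=
  \sum_(0 <= i < (size s).-1) mdist (gamma s`_i) (gamma s`_i.+1).

(* The empty sequence is allowed and contributes 0, as a one-point one does. *)
Definition curve_length (R : realType) (X : metricType R) (T : R)
    (gamma : R -> X) : \bar R :=
  ereal_sup [set (polygonal_length gamma s)%:E | s in
    [set s : seq R | sorted <%R s /\ {subset s <= `[0, T]}]].

Definition rectifiable (R : realType) (X : metricType R) (T : R)
    (gamma : R -> X) : Prop :=
  (curve_length T gamma < +oo)%E.

(* Main.v *)
(** Sample the curve at finitely many parameters, with distances [d i j].  If
    the sampled length is huge compared with the diameter, then cut the sample
    into links of comparable length-to-distance ratio; the distances to finitely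
    many later points [Z] telescope along the links, up to a [lam]-error, so for
    most links they decrease much less than the size of the link.  A charging
    argument yields such a link [u, v] preceded by a stretch of comparable size.
    A point of the stretch cannot be close to both [u] and [v], and from
    whichever of them is far, the points of [Z] do not look much closer.  SRA
    freeness bounds separated sets, so a tiny piece of the stretch still has a
    huge length ratio; adding [u] or [v] to [Z] and iterating inside the piece
    produces arbitrarily large sets in which all rough angles are small. *)
Require Import Defs.
From mathcomp Require Import all_boot all_order all_algebra.
From mathcomp Require Import all_classical all_reals ereal topology.
From mathcomp Require Import ring lra zify.

Set Implicit Arguments.
Unset Strict Implicit.
Unset Printing Implicit Defensive.

Import Order.TTheory GRing.Theory Num.Theory.

Local Open Scope classical_set_scope.
Local Open Scope ring_scope.

(** * Combinatorics of finite sequences *)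

Lemma pigeonhole_filter (T : Type) (c : T -> nat) (q P : nat) (s : seq T) :
  all (fun x => c x < q)%N s -> (q * P < size s + q)%N ->
  exists2 b, (b < q)%N & (P <= count (fun x => c x == b) s)%N.
Proof.
elim: q s => [|q IH] s cs szs.
  by move: szs; case: s cs => //= x s /andP[].
have [le|lt] := leqP P (count (fun x => c x == q) s); first by exists q.
have [||b ltb le] := IH [seq x <- s | c x != q].
- rewrite all_filter; apply: sub_all cs => x /=; case: eqP => //= h1 h2; lia.
- rewrite size_filter; have := count_predC (fun x => c x == q) s.
  by have -> : count (predC (fun x => c x == q)) s = count (fun x => c x != q) s
    by []; move: szs; rewrite mulSn; lia.
exists b; first lia.
apply: leq_trans le _; rewrite count_filter.
by apply: sub_count => x /= /andP[].
Qed.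

(* The colour is only asked to depend on the smaller index, so one application
   of the pigeonhole principle per extracted element suffices. *)
Lemma monochromatic_sublist (c : nat -> nat -> nat) (q M : nat) (s : seq nat) :
  sorted ltn s ->
  (forall i j, i \in s -> j \in s -> (i < j)%N -> (c i j < q.+1)%N) ->
  (q.+2 ^ M <= size s)%N ->
  exists t, [/\ subseq t s, size t = M &
    forall i j k, i \in t -> j \in t -> k \in t -> (i < j < k)%N ->
      c i j = c i k].
Proof.
elim: M s => [|M IH] s srt cs szs.
  by exists [::]; split => //; apply: sub0seq.
case: s srt cs szs => [|i s] srt cs szs.
  by move: szs; rewrite leqn0 expn_eq0.
have := srt; rewrite /= (path_sortedE ltn_trans) => /andP[/allP lti srt'].
have [||b _ le] := @pigeonhole_filter _ (c i) q.+1 (q.+2 ^ M) s.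
- by apply/allP => x xs; apply: cs; rewrite ?inE ?eqxx ?xs ?orbT ?lti.
- by have := expn_gt0 q.+2 M; move: szs; rewrite expnS /=; nia.
rewrite -size_filter in le.
have sub := filter_subseq (fun x => c i x == b) s.
have [|x y xs ys|t [tsub szt ht]] := IH _ _ _ le.
- exact: subseq_sorted ltn_trans _ _ sub srt'.
- by apply: cs; rewrite inE (mem_subseq sub) ?orbT.
have tb x : x \in t -> c i x = b /\ (i < x)%N.
  by move=> /(mem_subseq tsub); rewrite mem_filter => /andP[/eqP-> /lti].
exists (i :: t); split=> [||x y z]; rewrite /= ?eqxx ?szt //.
  exact: subseq_trans tsub sub.
rewrite !inE => /predU1P[->|xt] /predU1P[->|yt] /predU1P[->|zt]; try lia.
- by move=> _; rewrite (tb _ yt).1 (tb _ zt).1.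
- by have := tb _ xt; lia.
- by have := tb _ xt; lia.
- exact: ht.
Qed.

(* [W] and [G] are the partial sums of a sequence of lengths and of a sequence
   of costs.  The proof removes terms from the right: the last term is either
   expensive, and its length is charged to the costs of its block, or it is much
   shorter than some earlier term, which pays for it. *)
Lemma cheap_block (R : realType) (W G : nat -> R) (eps omega : R) (n : nat) :
  0 < eps -> 0 <= omega -> (forall i, (i < n)%N -> 0 < W i.+1 - W i <= omega) ->
  (forall i j, (i <= j)%N -> (j <= n)%N -> G i <= G j) ->
  (10%:R / eps) * (G n - G 0%N) + 2%:R * omega < 3%:R / 4%:R * (W n - W 0%N) ->
  exists k i, [/\ (k < i < n)%N,
    W i.+1 - W i <= W i - W k, W i - W k <= 9%:R * (W i.+1 - W i) &
    G i.+1 - G k <= eps * (W i.+1 - W i)].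
Proof.
move=> eps0 om0 hW hG small; apply: contrapT => none.
have A0 : 0 <= 10%:R / eps by rewrite divr_ge0 ?ler0n ?ltW.
have mW i j : (i <= j)%N -> (j <= n)%N -> W i <= W j.
  elim: j => [|j IH]; first by rewrite leqn0 => /eqP->.
  rewrite leq_eqVlt => /predU1P[->//|lij] ltj.
  by apply: le_trans (IH lij (ltnW ltj)) _; have := hW _ ltj; lra.
have key m : (m <= n)%N -> W m - W 0%N <=
    10%:R / eps * (G m - G 0%N) + (W m.-1 - W 0%N) / 4%:R + 2%:R * omega.
  elim/ltn_ind: m => -[|i] IH hi.
    by rewrite !subrr mulr0; lra.
  have wi := hW _ hi.
  have [lt|ge] := ltrP (W i - W 0%N) (W i.+1 - W i).
    have G0 : 0 <= 10%:R / eps * (G i.+1 - G 0%N).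
      by rewrite mulr_ge0 // subr_ge0 hG.
    have := mW _ _ (leq0n i) (ltnW hi).
    by rewrite /=; lra.
  pose P k := (k <= i)%N && (W i.+1 - W i <= W i - W k).
  have exP : exists k, P k by exists 0%N; rewrite /P ge.
  have [|k /andP[leki Pk] kmax] := @ex_maxnP P i exP.
    by move=> k /andP[].
  have ltki : (k < i)%N.
    by rewrite ltn_neqAle leki andbT; apply: contraTneq Pk => ->; lra.
  have Pk1 : W i - W k.+1 < W i.+1 - W i.
    rewrite ltNge; apply/negP => h.
    by have := kmax k.+1; rewrite /P ltki h ltnn => /(_ isT).
  (* A block of at most 9 times the last term must be costly, and its cost then covers the 10 terms'
     worth of length from [k] to [i.+1]. *)
  have [le9|gt9] := lerP (W i - W k) (9%:R * (W i.+1 - W i)).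
    have costly : eps * (W i.+1 - W i) < G i.+1 - G k.
      by rewrite ltNge; apply/negP => h; apply: none; exists k, i; split; rewrite ?ltki.
    have IHk := IH k (leqW ltki) (ltnW (ltn_trans ltki hi)).
    have := mW _ _ (leq_trans (leq_pred k) leki) (ltnW hi).
    have : 10%:R * (W i.+1 - W i) <= 10%:R / eps * (G i.+1 - G k).
      by rewrite -mulrA ler_pM2l ?ltr0n // mulrC ler_pdivlMr // mulrC ltW.
    move: IHk; rewrite /=; lra.
  (* By maximality of [k], the term at [k] is more than 8 times the last one; a quarter of it pays
     for the length after [k.+1], less than 2 last terms. *)
  have IHk := IH k.+1 ltki (leq_trans ltki (ltnW hi)).
  have := mW _ _ ltki (ltnW hi).
  have : 10%:R / eps * (G k.+1 - G 0%N) <= 10%:R / eps * (G i.+1 - G 0%N).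
    by rewrite ler_wpM2l // lerD2r hG // ltnW.
  move: IHk; rewrite /=; lra.
have := key n (leqnn _); have := mW _ _ (leq_pred n) (leqnn n).
lra.
Qed.

(* The distances [d i j] between the points [x_0, ..., x_n] of a finite
   injective rough self-contracting curve. *)
Record self_contracting_dist (R : realType) (lam : R) (n : nat)
    (d : nat -> nat -> R) : Prop := SelfContractingDist {
  scd_diag : forall i, d i i = 0 ;
  scd_sym : forall i j, d i j = d j i ;
  scd_triangle : forall i j k, d i k <= d i j + d j k ;
  scd_gt0 : forall i j, (i < j <= n)%N -> 0 < d i j ;
  scd_le : forall i j k, (i <= j)%N -> (j <= k)%N -> (k <= n)%N ->
    d j k <= d i k + lam * d i j
}.

Definition chain_length (R : realType) (d : nat -> nat -> R) (x : nat) : R :=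
  \sum_(0 <= i < x) d i i.+1.

(** * Geometry of finite self-contracting sequences *)

Section SelfContractingDist.

Variables (R : realType) (d : nat -> nat -> R) (lam : R) (n : nat).
Hypothesis scd : self_contracting_dist lam n d.
Hypothesis lam_small : lam <= 4%:R^-1.

Let L := chain_length d.

Lemma scd_ge0 i j : 0 <= d i j.
Proof.
have := scd_triangle scd i j i.
by rewrite (scd_diag scd) (scd_sym scd j i); lra.
Qed.

Lemma scd_le4 i j k : (i <= j)%N -> (j <= k)%N -> (k <= n)%N ->
  d j k <= d i k + d i j / 4%:R.
Proof.
move=> ij jk kn; apply: le_trans (scd_le scd ij jk kn) _.
by rewrite lerD2l mulrC ler_wpM2l // scd_ge0.
Qed.

(** Bounding [d a x] by [d a b + d x b] and absorbing [d x b / 4] gives the factor 5/3. *)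
Lemma scd_end a b x : (a <= x)%N -> (x <= b)%N -> (b <= n)%N ->
  d x b <= 2%:R * d a b.
Proof.
move=> ax xb bn; have := scd_le4 ax xb bn.
have := scd_triangle scd a b x; rewrite (scd_sym scd b x).
have := scd_ge0 a b; lra.
Qed.

Lemma scd_start a b x : (a <= x)%N -> (x <= b)%N -> (b <= n)%N ->
  d a x <= 3%:R * d a b.
Proof.
move=> ax xb bn; have := scd_end ax xb bn.
have := scd_triangle scd a b x; rewrite (scd_sym scd b x).
have := scd_ge0 a b; lra.
Qed.

Lemma scd_diam a b x y : (a <= x)%N -> (x <= b)%N -> (a <= y)%N ->
  (y <= b)%N -> (b <= n)%N -> d x y <= 4%:R * d a b.
Proof.
move=> ax xb ay yb bn; have := scd_end ax xb bn; have := scd_end ay yb bn.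
have := scd_triangle scd x b y; rewrite (scd_sym scd b y); lra.
Qed.

Lemma chain_lengthS x : L x.+1 = L x + d x x.+1.
Proof. by rewrite /L /chain_length big_nat_recr. Qed.

(** Each step is at most [4 * d u v], hence a quarter of the total, so the first point past a
    quarter of the length leaves more than half of it. *)
Lemma chain_length_median u v : (u < v <= n)%N ->
    16%:R * d u v <= L v - L u ->
  exists w, [/\ (u < w < v)%N, (L v - L u) / 4%:R <= L w - L u &
    (L v - L u) / 4%:R <= L v - L w].
Proof.
move=> /andP[uv vn] long; have duv : 0 < d u v by apply: (scd_gt0 scd); rewrite uv.
pose P w := (u <= w)%N && ((L v - L u) / 4%:R <= L w - L u).
have Pv : P v by rewrite /P (ltnW uv) /=; lra.
have exP : exists w, P w by exists v.
have [w /andP[uw Pw] wmin] := ex_minnP exP.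
have wv := wmin _ Pv.
case: w uw Pw wmin wv => [|w] uw Pw wmin wv.
  by move: uw; rewrite leqn0 => /eqP u0; subst u; lra.
have {}uw : (u <= w)%N.
  by move: uw; rewrite leq_eqVlt => /predU1P[|//] uE; move: Pw; rewrite -uE; lra.
have notPw : L w - L u < (L v - L u) / 4%:R.
  rewrite ltNge; apply/negP => h.
  by have := wmin w; rewrite /P uw h ltnn => /(_ isT).
have := scd_diam uw (ltnW wv) (leqW uw) wv vn.
have := chain_lengthS w => LS stepw.
exists w.+1; split; [|by []|lra].
rewrite ltnS uw /= ltn_neqAle wv andbT; apply/eqP => wE.
by move: LS stepw; rewrite wE; lra.
Qed.

(** Cut at medians until the ratio is at most [12 * rho]. Above that threshold each part has length
    at least [3 * rho * d a b] and endpoints at most [3 * d a b] apart, so it inherits the lower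
    bound. *)
Lemma chain_subdivision (rho : R) a b : 2%:R <= rho -> (a < b <= n)%N ->
    rho * d a b <= L b - L a ->
  exists m u, [/\ u 0%N = a, u m = b & forall i, (i < m)%N ->
    [/\ (u i < u i.+1)%N, rho * d (u i) (u i.+1) <= L (u i.+1) - L (u i) &
      L (u i.+1) - L (u i) <= 12%:R * rho * d (u i) (u i.+1)]].
Proof.
move=> rho2; have [k] := ubnP (b - a)%N.
elim: k a b => // k IH a b hk /andP[ab bn] lo.
have [hi|hi] := lerP (L b - L a) (12%:R * rho * d a b).
  by exists 1%N, (fun i => if i == 0%N then a else b); split=> // -[].
have dab : 0 < d a b by apply: (scd_gt0 scd); rewrite ab.
have rd : 2%:R * d a b <= rho * d a b by rewrite ler_wpM2r // ltW.
have [||w [/andP[aw wb] law lwb]] := @chain_length_median a b.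
- by rewrite ab.
- by rewrite -mulrA in hi; lra.
have bnd x : x <= 3%:R * d a b -> rho * x <= (L b - L a) / 4%:R.
  move=> hx; have : rho * x <= rho * (3%:R * d a b) by rewrite ler_wpM2l //; lra.
  by rewrite -mulrA mulrCA in hi; rewrite mulrCA; lra.
have [|||m1 [u1 [u1a u1w h1]]] := IH a w.
- by move: hk; lia.
- by rewrite aw (leq_trans (ltnW wb)).
- by apply: le_trans (bnd _ _) law; apply: scd_start => //; apply: ltnW.
have [|||m2 [u2 [u2w u2b h2]]] := IH w b.
- by move: hk; lia.
- by rewrite wb.
- apply: le_trans (bnd _ _) lwb.
  by have := scd_end (ltnW aw) (ltnW wb) bn; lra.
exists (m1 + m2)%N, (fun i => if (i <= m1)%N then u1 i else u2 (i - m1)%N).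
split=> //= [|i him].
  case: leqP => [|_]; last by rewrite addKn.
  rewrite -[X in (_ <= X)%N]addn0 leq_add2l leqn0 => /eqP m20.
  by rewrite m20 addn0 u1w -u2w -u2b m20.
have [lt|ge] := ltnP i m1; first by rewrite (ltnW lt); apply: h1.
have lt2 : (i - m1 < m2)%N by rewrite ltn_subLR.
move: ge; rewrite leq_eqVlt => /predU1P[eq|gt].
  rewrite -eq leqnn subSnn u1w -u2w; apply: h2.
  by rewrite -eq subnn in lt2.
have -> : (i <= m1)%N = false by rewrite leqNgt gt.
rewrite (subSn (ltnW gt)); exact: (h2 (i - m1)%N).
Qed.

End SelfContractingDist.

(* For indices [p < q < r] the SRA inequality whose left-hand side is [d q r]
   already follows from self-contraction. *)
Definition narrow (R : realType) (alpha : R) (d : nat -> nat -> R)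
    (s : seq nat) : Prop :=
  forall p q r, p \in s -> q \in s -> r \in s -> (p < q < r)%N ->
    d p r <= Num.max (d p q + alpha * d q r) (alpha * d p q + d q r) /\
    d p q <= Num.max (d p r + alpha * d q r) (alpha * d p r + d q r).

(** * Packing bounds from SRA freeness *)

Section Packing.

Variables (R : realType) (alpha : R) (d : nat -> nat -> R) (lam : R) (n N : nat).
Hypothesis alpha_gt0 : 0 < alpha.
Hypothesis scd : self_contracting_dist lam n d.
Hypothesis lam_small : lam <= 4%:R^-1.
Hypothesis narrow_size : forall s, sorted ltn s -> {in s, forall i, i <= n}%N ->
  narrow alpha d s -> (size s <= N)%N.

Let L := chain_length d.

(** The size from which [monochromatic_sublist] extracts [N.+1] elements when the colours are
    buckets of width [alpha * delta] for distances up to [K * delta]. *)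
Definition packing_bound (K : R) : nat := (Num.truncn (K / alpha)).+2 ^ N.+1.

(* Thin the set so that, for [p < q < r], the distances [d p q] and [d p r] lie
   in the same bucket of width [alpha * delta <= alpha * d q r]. *)
Lemma separated_size (delta K : R) (s : seq nat) : 0 < delta ->
    sorted ltn s -> {in s, forall i, i <= n}%N ->
    {in s &, forall i j, (i < j)%N -> delta <= d i j <= K * delta} ->
  (size s < packing_bound K)%N.
Proof.
move=> delta0 srt sn sep; rewrite ltnNge; apply/negP => big.
have ad0 : 0 < alpha * delta by rewrite mulr_gt0.
pose c i j := Num.truncn (d i j / (alpha * delta)).
have cP i j : (c i j)%:R * (alpha * delta) <= d i j < (c i j).+1%:R * (alpha * delta).
  rewrite -ler_pdivlMr // -ltr_pdivrMr //; apply: truncn_itv.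
  by rewrite divr_ge0 ?(scd_ge0 scd) // ltW.
have [|t [tsub szt tc]] := @monochromatic_sublist c _ N.+1 s srt _ big.
  move=> i j si sj ij; rewrite ltnS; apply: le_truncn.
  rewrite ler_pdivrMr // mulrA divfK ?gt_eqF //.
  by have /andP[] := sep _ _ si sj ij.
have tin i : i \in t -> i \in s by apply: mem_subseq.
suff : (size t <= N)%N by rewrite szt ltnn.
apply: narrow_size => [|i /tin /sn//|p q r pt qt rt pqr].
  exact: subseq_sorted ltn_trans _ _ tsub srt.
have cE := tc _ _ _ pt qt rt pqr.
have := cP p q; have := cP p r; rewrite -cE => /andP[lo1 hi1] /andP[lo2 hi2].
have /andP[_ qr] := pqr.
have /andP[+ _] := sep _ _ (tin _ qt) (tin _ rt) qr.
rewrite -(ler_pM2l alpha_gt0) => dqr.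
rewrite -natr1 mulrDl mul1r in hi1 hi2.
by rewrite !le_max; split; apply/orP; left; lra.
Qed.

(* Cutting greedily at the first point farther than [delta] from the previous
   cut either meets a long piece or produces a separated set. *)
Lemma long_piece_or_separated (delta K X : R) q r u : 0 <= delta ->
    (r <= u)%N -> (u <= n)%N ->
    (forall x y, (r <= x <= u)%N -> (r <= y <= u)%N -> d x y <= K) ->
    q%:R * (X + K) < L u - L r -> 0 <= X ->
  (exists a b, [/\ (r <= a)%N, (a <= b)%N, (b <= u)%N, X <= L b - L a &
    forall p, (a <= p <= b)%N -> d a p <= delta]) \/
  (exists c, [/\ path ltn r c, size c = q, {in c, forall i, r < i <= u}%N &
    {in r :: c &, forall i j, (i < j)%N -> 3%:R / 8%:R * delta <= d i j}]).
Proof.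
move=> delta0 + un + + X0; elim: q r => [|q IH] r ru diam long.
  right; exists [::]; split=> // i j; rewrite !inE => /eqP-> /eqP->.
  by rewrite ltnn.
have K0 : 0 <= K by apply: le_trans (scd_ge0 scd r r) (diam r r _ _); rewrite leqnn.
have [far|near] := pselect (exists p, (r < p <= u)%N && (delta < d r p)); last first.
  left; exists r, u; split=> // [|p /andP[rp pu]].
    have : 0 <= q%:R * (X + K) by rewrite mulr_ge0 ?ler0n ?addr_ge0.
    by move: long; rewrite -natr1 mulrDl; lra.
  rewrite leNgt; apply/negP => h; apply: near; exists p.
  rewrite h pu ltn_neqAle rp !andbT; apply/eqP => rE.
  by move: h; rewrite -rE (scd_diag scd); lra.
have [t /andP[/andP[rt tu] drt] tmin] := ex_minnP far.
case: t rt tu drt tmin => // t rt tu drt tmin.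
have near p : (r <= p <= t)%N -> d r p <= delta.
  move=> /andP[rp pt]; rewrite leNgt; apply/negP => h.
  have := tmin p; rewrite h (leq_trans pt (ltnW tu)) ltn_neqAle rp !andbT.
  have -> : r != p by apply: contraTneq h => <-; rewrite (scd_diag scd) -leNgt.
  by move=> /(_ isT); rewrite ltnNge pt.
have [longt|shortt] := lerP X (L t - L r).
  by left; exists r, t; split=> //; apply: ltnW.
have stept : d t t.+1 <= K.
  by apply: diam; [rewrite -ltnS rt ltnW|rewrite (ltnW rt) tu].
have LS := chain_lengthS d t.
have long' : q%:R * (X + K) < L u - L t.+1.
  by move: long shortt LS; rewrite -natr1 mulrDl -/L; lra.
have diam' x y : (t < x <= u)%N -> (t < y <= u)%N -> d x y <= K.
  move=> /andP[tx xu] /andP[ty yu].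
  by apply: diam; rewrite ?xu ?yu andbT (leq_trans (ltnW rt)).
have [[a [b [ta ab bu Xab near']]]|[c [pc szc cin csep]]] := IH _ tu diam' long'.
  by left; exists a, b; split=> //; apply: leq_trans ta; apply: ltnW.
right; exists (t.+1 :: c); split=> [||i|]; rewrite /= ?szc ?rt //.
  rewrite inE => /predU1P[->|/cin /andP[ti ->]]; first by rewrite rt.
  by rewrite (ltn_trans rt ti).
have tle i : i \in t.+1 :: c -> (t < i <= u)%N.
  rewrite inE => /predU1P[->|/cin /andP[ti ->]]; first by rewrite leqnn.
  by rewrite ltnW.
(* Self-contraction and the triangle inequality through [j] bound [3/4 * d r t.+1] by [2 * d r j],
   whence 3/8. *)
have rsep j : j \in t.+1 :: c -> 3%:R / 8%:R * delta <= d r j.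
  move=> /tle /andP[tj ju].
  have := scd_le4 scd lam_small (ltnW rt) tj (leq_trans ju un).
  by have := scd_triangle scd r j t.+1; rewrite (scd_sym scd j); lra.
move=> i j; rewrite in_cons => /predU1P[->|ic]; rewrite in_cons => /predU1P[->|jc].
- by rewrite ltnn.
- by move=> _; apply: rsep.
- have /andP[ti _] := tle _ ic; move=> ir.
  by move: (ltn_trans (leq_ltn_trans ti ir) rt); rewrite ltnn.
- exact: csep.
Qed.

End Packing.

(** * Links along which many distances barely decrease *)

Section CheapLink.

Variables (R : realType) (d : nat -> nat -> R) (lam : R) (n : nat).
Hypothesis scd : self_contracting_dist lam n d.
Hypothesis lam_ge0 : 0 <= lam.
Hypothesis lam_small : lam <= 4%:R^-1.

Let L := chain_length d.

Lemma monotone_interval (u : nat -> nat) k i p : (k < i)%N ->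
    (u k <= p)%N -> (p <= u i)%N ->
  exists l, [/\ (k <= l)%N, (l < i)%N, (u l <= p)%N & (p <= u l.+1)%N].
Proof.
elim: i => // i IH ki kp pi; have [ip|lt] := leqP (u i) p.
  by exists i; split.
move: ki; rewrite ltnS leq_eqVlt => /predU1P[kE|ki].
  by move: (leq_ltn_trans kp lt); rewrite kE ltnn.
have [l [kl li lp pl]] := IH ki kp (ltnW lt).
by exists l; split=> //; apply: ltnW.
Qed.

(** [cheap_block] is applied to a subdivision, with chord lengths as terms and decreases of the
    distances to [Z] as costs. These telescope to at most [d a b] per point of [Z], up to a
    [lam]-error, while the chords add up to a large multiple of [d a b]. *)
Lemma cheap_link (eps rho : R) (a b : nat) (Z : seq nat) :
    0 < eps -> 2%:R <= rho -> (a < b <= n)%N -> {in Z, forall z, b <= z <= n}%N ->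
    10%:R / eps * (size Z)%:R * lam <= 16%:R^-1 ->
    12%:R * rho * (20%:R / eps * (size Z)%:R + 16%:R) * d a b <= L b - L a ->
  exists r u v, [/\ (a <= r)%N, (r <= u)%N, (u < v)%N & (v <= b)%N] /\
    [/\ rho * d u v <= L u - L r,
      forall p, (r <= p <= u)%N -> d p u <= 18%:R * d u v &
      forall p z, (r <= p <= u)%N -> z \in Z ->
        d p z <= d u z + (eps + 27%:R * lam) * d u v /\
        d p z <= d v z + (eps + 27%:R * lam) * d u v].
Proof.
move=> eps0 rho2 abn Zb lamZ long; have /andP[ab bn] := abn.
have dab : 0 < d a b by apply: (scd_gt0 scd).
have long' : rho * d a b <= L b - L a.
  have rd : 0 <= rho * d a b by rewrite mulr_ge0 ?ltW //; lra.
  have : 0 <= 20%:R / eps * (size Z)%:R * (rho * d a b).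
    by rewrite mulr_ge0 // mulr_ge0 ?ler0n // divr_ge0 ?ler0n ?ltW.
  by move: long rd; lra.
have [m [u [u0 um hu]]] := chain_subdivision scd lam_small rho2 abn long'.
rewrite -/L in hu.
have umono i j : (i <= j)%N -> (j <= m)%N -> (u i <= u j)%N.
  elim: j => [|j IH]; first by rewrite leqn0 => /eqP->.
  rewrite leq_eqVlt => /predU1P[->//|lij] ltj.
  by apply: leq_trans (IH lij (ltnW ltj)) _; have [/ltnW] := hu _ ltj.
have uab i : (i <= m)%N -> (a <= u i <= b)%N.
  by move=> im; rewrite -u0 -um !umono.
pose W := chain_length (fun i j => d (u i) (u j)).
have WS i : W i.+1 = W i + d (u i) (u i.+1) by exact: chain_lengthS.
have W0 : W 0%N = 0 by rewrite /W /chain_length big_geq.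
have Wmono : {homo W : i j / (i <= j)%N >-> i <= j}.
  apply: homo_leq => // [|i]; first exact: le_trans.
  by rewrite WS lerDl (scd_ge0 scd).
have Wtri i j : (i <= j)%N -> d (u i) (u j) <= W j - W i.
  elim: j => [|j IH]; first by rewrite leqn0 => /eqP->; rewrite (scd_diag scd) subrr.
  rewrite leq_eqVlt => /predU1P[->|]; first by rewrite (scd_diag scd) subrr.
  by move=> /IH; have := scd_triangle scd (u i) (u j) (u j.+1); rewrite WS; lra.
have Llo i j : (i <= j)%N -> (j <= m)%N -> rho * (W j - W i) <= L (u j) - L (u i).
  elim: j => [|j IH]; first by rewrite leqn0 => /eqP->; rewrite !subrr mulr0.
  rewrite leq_eqVlt => /predU1P[->|ij jm]; first by rewrite !subrr mulr0.
  by have := IH ij (ltnW jm); have [_ + _] := hu _ jm; rewrite WS; lra.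
have Lhi i : (i <= m)%N -> L (u i) - L a <= 12%:R * rho * W i.
  elim: i => [|i IH] im; first by rewrite u0 W0 subrr mulr0.
  by have := IH (ltnW im); have [_ _ +] := hu _ im; rewrite WS; lra.
have WD : (20%:R / eps * (size Z)%:R + 16%:R) * d a b <= W m.
  have := Lhi m (leqnn m); rewrite um => /(le_trans long).
  by rewrite -mulrA ler_pM2l //; lra.
(* The correction [lam * W x] offsets the growth of [d (u x) z] that self-contraction permits, so
   [g z] is nondecreasing. *)
pose g z x := d (u 0%N) z - d (u x) z + lam * W x.
pose G x := \sum_(z <- Z) g z x.
have g_homo z i j : z \in Z -> (i <= j)%N -> (j <= m)%N -> g z i <= g z j.
  move=> zZ ij jm; have /andP[bz zn] := Zb z zZ.
  have /andP[_ ub] := uab _ jm.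
  have := scd_le scd (umono _ _ ij jm) (leq_trans ub bz) zn.
  have := ler_wpM2l lam_ge0 (Wtri _ _ ij).
  by rewrite /g; lra.
have G_homo i j : (i <= j)%N -> (j <= m)%N -> G i <= G j.
  move=> ij jm; rewrite /G big_seq [leRHS]big_seq.
  by apply: ler_sum => z zZ; apply: g_homo.
have gG z i j : z \in Z -> (i <= j)%N -> (j <= m)%N -> g z j - g z i <= G j - G i.
  move=> zZ ij jm; rewrite /G -sumrB big_seq (big_rem z) //= zZ lerDl.
  by apply: sumr_ge0 => y yZ; rewrite subr_ge0; apply: g_homo.
have Gm : G m - G 0%N <= (size Z)%:R * (d a b + lam * W m).
  have -> : (size Z)%:R * (d a b + lam * W m) = \sum_(z <- Z) (d a b + lam * W m).
    by rewrite big_const_seq count_predT iter_addr_0 mulr_natl.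
  rewrite /G -sumrB big_seq [leRHS]big_seq; apply: ler_sum => z zZ.
  by rewrite /g u0 um W0; have := scd_triangle scd a b z; lra.
have Wm0 : 0 < W m.
  apply: lt_le_trans WD; rewrite mulr_gt0 // ltr_wpDl ?ltr0n //.
  by rewrite mulr_ge0 ?ler0n // divr_ge0 ?ler0n ?ltW.
(* The terms in [d a b] amount to at most [W m / 2], and the one in [lam] to at most [W m / 16]. *)
have budget : 10%:R / eps * (G m - G 0%N) + 2%:R * (4%:R * d a b) <
    3%:R / 4%:R * (W m - W 0%N).
  have : 10%:R / eps * (G m - G 0%N) <=
      10%:R / eps * ((size Z)%:R * (d a b + lam * W m)).
    by rewrite ler_wpM2l // divr_ge0 ?ler0n ?ltW.
  have := ler_wpM2r (ltW Wm0) lamZ.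
  by move: WD Wm0; rewrite W0; lra.
have [|i im||k [i [/andP[ki im] wlo whi cost]]] :=
    @cheap_block R W G eps (4%:R * d a b) m eps0 _ _ _ budget.
- by rewrite mulr_ge0 ?ltW.
- have [uu _ _] := hu _ im; have /andP[a1 b1] := uab _ (ltnW im).
  have /andP[a2 b2] := uab _ im.
  rewrite WS addrAC subrr add0r (scd_gt0 scd) ?uu ?(leq_trans b2) //=.
  exact: (scd_diam scd lam_small).
- exact: G_homo.
have wE : W i.+1 - W i = d (u i) (u i.+1) by rewrite WS addrAC subrr add0r.
rewrite wE in wlo whi cost.
exists (u k), (u i), (u i.+1); split.
  have /andP[ak _] := uab _ (ltnW (ltn_trans ki im)).
  have /andP[_ bi] := uab _ im.
  by have [ui _ _] := hu _ im; split=> //; apply: umono; apply: ltnW.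
(* Each point is compared with the ends of its own link. As the block is at most 9 times the chosen
   chord, the factors 2 and 3 become 18 and 27. *)
have locate p : (u k <= p <= u i)%N -> exists l, [/\ (k <= l)%N, (l < i)%N,
    d p (u l.+1) <= 2%:R * (W l.+1 - W l) & d (u l) p <= 3%:R * (W l.+1 - W l)
    /\ (u l <= p)%N].
  move=> /andP[kp pi]; have [l [kl li lp pl]] := monotone_interval ki kp pi.
  have lm := ltn_trans li im; have /andP[_ lb] := uab _ lm.
  exists l; rewrite WS addrAC subrr add0r; split=> //.
    exact: (scd_end scd lam_small lp pl (leq_trans lb bn)).
  by split=> //; exact: (scd_start scd lam_small lp pl (leq_trans lb bn)).
split=> [|p /locate [l [kl li dpl _]]|p z pki zZ].
- by apply: le_trans (Llo _ _ (ltnW ki) (ltnW im)); rewrite ler_wpM2l //; lra.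
- have := scd_triangle scd p (u l.+1) (u i); have := Wtri _ _ li.
  by have := Wmono _ _ kl; have := Wmono _ _ li; lra.
have [l [kl li _ [dlp lp]]] := locate p pki.
have /andP[bz zn] := Zb z zZ; have /andP[_ pi] := pki.
have /andP[_ ib] := uab _ (ltnW im).
have := scd_le scd lp (leq_trans pi (leq_trans ib bz)) zn.
have l27 : d (u l) p <= 27%:R * d (u i) (u i.+1).
  by have := Wmono _ _ kl; have := Wmono _ _ li; lra.
have := ler_wpM2l lam_ge0 l27.
have lm := ltn_trans li im.
have step x : (l <= x)%N -> (x <= i.+1)%N ->
    d (u l) z - d (u x) z <= eps * d (u i) (u i.+1).
  move=> lx xi; have := gG z l x zZ lx (leq_trans xi im).
  have := G_homo _ _ kl (ltnW lm); have := G_homo _ _ xi im.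
  by have := ler_wpM2l lam_ge0 (Wmono _ _ lx); rewrite /g; lra.
have := step i (ltnW li) (leqnSn i).
have := step i.+1 (leqW (ltnW li)) (leqnn _).
by split; lra.
Qed.

End CheapLink.

(** * A smaller piece and a point far from it *)

Section NextPiece.

Variables (R : realType) (alpha : R) (N : nat).
Hypothesis alpha01 : 0 < alpha < 1.

(** SRA freeness is encoded as the bound [N] on narrow index sets, so that constants can be chosen
    uniformly over all samples. *)
Definition admissible (lam : R) (n : nat) (d : nat -> nat -> R) : Prop :=
  self_contracting_dist lam n d /\
  forall s, sorted ltn s -> {in s, forall i, i <= n}%N ->
    narrow alpha d s -> (size s <= N)%N.

(** With [w] the size of a cheap link, the stretch before it has room for [P] cuts, which
    [separated_size] forbids, so it contains a long piece within [w / 64] of its start. The point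
    [y] is an end of the link at least [w / 2] away from that start. *)
Lemma next_piece (Q : R) (k : nat) : 0 < Q ->
  exists Q' lam0, [/\ 0 < Q', 0 < lam0, lam0 <= 4%:R^-1 &
    forall lam n d, 0 <= lam <= lam0 -> admissible lam n d ->
    forall a b Z, (a < b <= n)%N -> (size Z <= k)%N ->
      {in Z, forall z, b <= z <= n}%N ->
      Q' * d a b <= chain_length d b - chain_length d a ->
    exists a' b' y, [/\ (a <= a')%N, (a' < b')%N, (b' < y)%N & (y <= b)%N] /\
      [/\ Q * d a' b' <= chain_length d b' - chain_length d a',
        forall p, (a' <= p <= b')%N -> 4%:R * d a' b' <= d p y &
        forall p z, (a' <= p <= b')%N -> z \in Z ->
          d p z <= d y z + alpha * d p y]].
Proof.
move=> Q0; have [alpha0 alpha1] := andP alpha01.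
(* 96 * 64 = 36 / (3 / 8 / 64) is the diameter of the stretch divided by the
   separation of the cuts. *)
pose P := packing_bound alpha N (96%:R * 64%:R).
(* Each of the [P] cuts uses up less than [(Q + 36) * w]; adding 2 gives strictness and
   [2 <= rho]. *)
pose rho := P%:R * (Q + 36%:R) + 2%:R.
pose eps := alpha / 8%:R.
have eps0 : 0 < eps by rewrite divr_gt0 ?ltr0n.
have rho2 : 2%:R <= rho.
  by rewrite lerDr mulr_ge0 ?ler0n // addr_ge0 ?ler0n ?ltW.
(* The first witness is the ratio [cheap_link] asks for. The second gives
   [10 / eps * k * lam <= 1/16], since [10 / eps = 80 / alpha], and [27 * lam <= alpha / 8]. *)
exists (12%:R * rho * (20%:R / eps * k%:R + 16%:R)), (alpha / (1280%:R * k.+1%:R)).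
have k0 : 0 <= (k%:R : R) by apply: ler0n.
have k1 : 0 < 1280%:R * k.+1%:R :> R by rewrite mulr_gt0 ?ltr0n.
have c0 : 0 <= 20%:R / eps * k%:R.
  by rewrite mulr_ge0 // divr_ge0 ?ler0n ?ltW.
split.
- by rewrite !mulr_gt0 ?ltr0n //; [lra|rewrite ltr_wpDl ?ltr0n].
- by rewrite divr_gt0.
- by rewrite ler_pdivrMr // -[k.+1%:R]natr1; lra.
move=> lam n d /andP[lam0 lamk] [scd nsz] a b Z abn szZ Zb long.
have lamk' : 1280%:R * (lam * k.+1%:R) <= alpha.
  by move: lamk; rewrite ler_pdivlMr // mulrCA.
rewrite -[k.+1%:R]natr1 in lamk'.
have lk0 : 0 <= lam * k%:R by rewrite mulr_ge0.
have lam4 : lam <= 4%:R^-1 by lra.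
have lam27 : eps + 27%:R * lam <= alpha / 4%:R by rewrite /eps; lra.
have szZ' : (size Z)%:R <= (k%:R : R) by rewrite ler_nat.
have lamZ : 10%:R / eps * (size Z)%:R * lam <= 16%:R^-1.
  have -> : 10%:R / eps * (size Z)%:R * lam = 10%:R * (lam * (size Z)%:R) / eps.
    by ring.
  rewrite ler_pdivrMr // /eps.
  by have := ler_wpM2l lam0 szZ'; lra.
have [|r [u [v [[ar ru uv vb] [rhow diam cheap]]]]] :=
    cheap_link scd lam0 lam4 eps0 rho2 abn Zb lamZ.
  apply: le_trans long; rewrite ler_wpM2r ?(scd_ge0 scd) // ler_wpM2l //; first lra.
  by rewrite lerD2r ler_wpM2l // divr_ge0 ?ler0n ?ltW.
have /andP[ab bn] := abn; have vn := leq_trans vb bn.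
clear lam0 lamk lamk' lk0 lamZ szZ szZ' long k0 k1 c0 rho2 eps0 ab.
set w := d u v in rhow diam cheap.
have w0 : 0 < w by rewrite (scd_gt0 scd) ?uv.
have un : (u <= n)%N := leq_trans (ltnW uv) vn.
have w64 : 0 <= w / 64%:R by rewrite divr_ge0 ?ler0n ?ltW.
have diam36 x y : (r <= x <= u)%N -> (r <= y <= u)%N -> d x y <= 36%:R * w.
  move=> /diam hx /diam hy; have := scd_triangle scd x u y.
  by rewrite (scd_sym scd u y); lra.
have [| |[a' [b' [ra ab' bu Xab near]]]|[c [pc szc cin csep]]] :=
  @long_piece_or_separated _ d lam n scd lam4 _ _ (Q * w) P r u w64 ru un diam36.
- apply: lt_le_trans rhow; rewrite /rho -mulrDl mulrA; nra.
- by rewrite mulr_ge0 ?ltW.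
- have nearw : d a' b' <= w / 64%:R by apply: near; rewrite ab' leqnn.
  have ltab : (a' < b')%N.
    rewrite ltn_neqAle ab' andbT; apply: contraTneq Xab => ->.
    by rewrite subrr -ltNge mulr_gt0.
  have [y yuv yfar] : exists2 y, y = u \/ y = v & w / 2%:R <= d a' y.
    have [|lt] := lerP (w / 2%:R) (d a' u); first by exists u => //; left.
    exists v; first by right.
    have := scd_triangle scd u a' v; rewrite (scd_sym scd u a') -/w; lra.
  have far p : (a' <= p <= b')%N -> w / 4%:R <= d p y.
    by move=> /near; have := scd_triangle scd a' p y; lra.
  exists a', b', y; split; first split=> //.
  + exact: leq_trans ar ra.
  + case: yuv => yE; last by rewrite yE (leq_ltn_trans bu).
    rewrite ltn_neqAle yE bu andbT; apply/eqP => bE.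
    have := far b'; rewrite ab' leqnn => /(_ isT).
    by rewrite yE bE (scd_diag scd) leNgt divr_gt0 ?ltr0n.
  + by case: yuv => ->; rewrite // (leq_trans (ltnW uv)).
  split=> [|p /far|p z pab zZ]; [|lra|].
    by apply: le_trans Xab; rewrite ler_wpM2l ?ltW //; lra.
  have pru : (r <= p <= u)%N.
    by case/andP: pab => ap pb; rewrite (leq_trans ra ap) (leq_trans pb bu).
  (* The error is at most [alpha * w / 4], and [w / 4 <= d p y]. *)
  have [cu cv] := cheap p z pru zZ.
  have := ler_wpM2l (ltW alpha0) (far p pab).
  have : (eps + 27%:R * lam) * w <= alpha / 4%:R * w.
    exact: ler_wpM2r (ltW w0) _ _ lam27.
  by case: yuv => ->; lra.
have cn i : i \in r :: c -> (r <= i <= u)%N.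
  by rewrite inE => /predU1P[->|/cin /andP[/ltnW-> ->]//]; rewrite leqnn.
suff : (size (r :: c) < P)%N by rewrite /= szc ltnNge leqnSn.
apply: (separated_size alpha0 scd nsz (delta := 3%:R / 8%:R * (w / 64%:R))
  (K := 96%:R * 64%:R)).
- by rewrite mulr_gt0 ?divr_gt0 ?ltr0n.
- by [].
- by move=> i /cn /andP[_ iu]; apply: leq_trans un.
- move=> i j ic jc ij; rewrite csep //=.
  by have := diam36 _ _ (cn _ ic) (cn _ jc); lra.
Qed.

End NextPiece.

(** * Iteration and the bound on the length *)

Section NarrowPoints.

Variables (R : realType) (alpha : R) (N : nat).
Hypothesis alpha01 : 0 < alpha < 1.

(** Points are found from last to first: [next_piece] yields the last one, [y], which joins [Z]
    while the search goes on inside the smaller piece. Hence [m] stays general in the induction on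
    [k]. *)
Lemma narrow_points (k m : nat) :
  exists Q lam0, [/\ 0 < Q, 0 < lam0 & forall lam n (d : nat -> nat -> R),
    0 <= lam <= lam0 -> admissible alpha N lam n d ->
    forall a b Z, (a < b <= n)%N -> (size Z <= m)%N ->
      {in Z, forall z, b <= z <= n}%N ->
      (forall x z, (a <= x <= b)%N -> z \in Z -> 4%:R * d a b <= d x z) ->
      Q * d a b <= chain_length d b - chain_length d a ->
    exists s, [/\ sorted ltn s, size s = k, {in s, forall i, a <= i <= b}%N &
      forall p q z, p \in s -> q \in s -> z \in s ++ Z -> (p < q < z)%N ->
        d p q <= d q z /\ d p z <= d q z + alpha * d p q]].
Proof.
elim: k m => [|k IH] m.
  by exists 1, 1; split=> // lam n d _ _ a b Z _ _ _ _ _; exists [::].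
have [Q1 [lam1 [Q10 lam10 H]]] := IH m.+1.
have [Q [lam2 [Q0 lam20 lam2a next]]] := next_piece N alpha01 m Q10.
exists Q, (Num.min lam1 lam2); split=> // [|lam n d].
  by rewrite lt_min lam10.
rewrite le_min => /and3P[lam0 lamle1 lamle2] adm a b Z abn szZ Zb Zfar long.
have /andP[ab bn] := abn.
have [|a' [b' [y [[aa ab' by' yb] [long' yfar Zy]]]]] :=
  next lam n d _ adm a b Z abn szZ Zb long; first by rewrite lam0.
have [scd _] := adm.
have lam4 : lam <= 4%:R^-1 := le_trans lamle2 lam2a.
have sub p : (a' <= p <= b')%N -> (a <= p <= b)%N.
  move=> /andP[ap pb]; rewrite (leq_trans aa ap).
  exact: leq_trans pb (leq_trans (ltnW by') yb).
have yab : (a <= y <= b)%N.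
  by rewrite yb andbT (leq_trans aa) // (leq_trans (ltnW ab')) // ltnW.
have diam p q : (a <= p <= b)%N -> (a <= q <= b)%N -> d p q <= 4%:R * d a b.
  by move=> /andP[ap pb] /andP[aq qb]; apply: (scd_diam scd lam4).
have ab'4 : d a' b' <= d a b.
  have ha : (a' <= a' <= b')%N by rewrite leqnn ltnW.
  by have := yfar _ ha; have := diam _ _ (sub _ ha) yab; lra.
have [|||||s [srt szs sab hs]] := H lam n d _ adm a' b' (y :: Z) _ _ _ _ long'.
- by rewrite lam0.
- by rewrite ab' (leq_trans (ltnW by')) // (leq_trans yb).
- by rewrite ltnS.
- move=> z; rewrite inE => /predU1P[->|/Zb /andP[bz ->]].
    by rewrite (ltnW by') (leq_trans yb).
  by rewrite andbT (leq_trans (ltnW by')) // (leq_trans yb).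
- move=> x z xab; rewrite inE => /predU1P[->|zZ]; first exact: yfar.
  by have := Zfar x z (sub _ xab) zZ; lra.
have sy i : i \in s -> (i < y)%N.
  by move=> /sab /andP[_ ib]; apply: leq_ltn_trans by'.
exists (rcons s y); split.
- rewrite (sorted_pairwise ltn_trans) pairwise_rcons -(sorted_pairwise ltn_trans).
  by rewrite srt andbT; apply/allP => i; apply: sy.
- by rewrite size_rcons szs.
- by move=> i; rewrite mem_rcons inE => /predU1P[->//|/sab /sub].
move=> p q z; rewrite !mem_rcons !inE cat_rcons.
move=> /predU1P[->|ps] /predU1P[->|qs] zs pqz.
- by move: pqz; rewrite ltnn.
- by have /andP[yq _] := pqz; have := ltn_trans yq (sy _ qs); rewrite ltnn.
- have zZ : z \in Z.
    move: zs; rewrite mem_cat inE => /or3P[zs|/eqP zy|//].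
      by have /andP[_ yz] := pqz; have := ltn_trans yz (sy _ zs); rewrite ltnn.
    by move: pqz; rewrite zy ltnn andbF.
  (* Both [p] and [y] lie in a piece of diameter at most [4 * d a b], and [Z] is at least that far
     away. *)
  split; last exact: Zy (sab _ ps) zZ.
  apply: le_trans (Zfar y z yab zZ).
  exact: diam (sub _ (sab _ ps)) yab.
- exact: hs.
Qed.

Lemma chain_length_bound : exists Q lam0, [/\ 0 < Q, 0 < lam0 <= alpha &
  forall n (d : nat -> nat -> R), admissible alpha N lam0 n d -> (0 < n)%N ->
    chain_length d n <= Q * d 0%N n].
Proof.
have [alpha0 alpha1] := andP alpha01.
have [Q [lam0 [Q0 lam00 H]]] := narrow_points N.+1 0.
(* The cap by [alpha] serves [narrow_SRA]. *)
exists Q, (Num.min lam0 alpha); split=> // [|n d adm n0].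
  by rewrite lt_min lam00 alpha0 ge_min lexx orbT.
have [scd nsz] := adm.
rewrite leNgt; apply/negP => long.
have [||||||s [srt szs sn hs]] := H _ n d _ adm 0%N n [::] _ _ _ _ _.
- by rewrite ge_min lexx andbT le_min !ltW.
- by rewrite n0 /=.
- by [].
- by [].
- by [].
- by rewrite [chain_length d 0%N]/chain_length big_geq // subr0 ltW.
suff : (size s <= N)%N by rewrite szs ltnn.
apply: nsz srt _ _ => [i /sn /andP[]//|p q r ps qs rs pqr].
have [] := hs p q r ps qs _ pqr; first by rewrite cats0.
move=> h1 h2; rewrite !le_max; split; apply/orP; right; first lra.
by have := mulr_ge0 (ltW alpha0) (scd_ge0 scd p r); lra.
Qed.

End NarrowPoints.

(** * Back to the metric space and the curve *)

(** By symmetry [i < j]. If [k] precedes both, self-contraction with [lam <= alpha] suffices; the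
    other two positions of [k] are the clauses of [narrow]. *)
Lemma narrow_SRA (R : realType) (alpha lam : R) (n : nat) (d : nat -> nat -> R)
    (s : seq nat) :
  0 < alpha -> lam <= alpha -> self_contracting_dist lam n d ->
  {in s, forall i, i <= n}%N -> narrow alpha d s ->
  {in s & &, forall i j k,
    d i j <= Num.max (d i k + alpha * d k j) (alpha * d i k + d k j)}.
Proof.
move=> alpha0 lama scd sn nrw i j k si sj sk.
wlog ij : i j si sj / (i <= j)%N => [hw|].
  have [/hw|/ltnW/hw] := leqP i j; first exact.
  move=> /(_ sj si); rewrite maxC (scd_sym scd j i) (scd_sym scd j k).
  by rewrite (scd_sym scd k i) addrC [X in Num.max _ X]addrC.
have ge0 := scd_ge0 scd; have scal x y := mulr_ge0 (ltW alpha0) (ge0 x y).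
move: ij; rewrite leq_eqVlt => /predU1P[->|ij].
  by rewrite (scd_diag scd) le_max addr_ge0.
case: (ltngtP k i) => [ki|ik|->]; last first.
- by rewrite (scd_diag scd) le_max mulr0 !add0r lexx orbT.
- case: (ltngtP k j) => [kj|jk|->]; last first.
  + by rewrite (scd_diag scd) le_max mulr0 !addr0 lexx.
  + by rewrite (scd_sym scd k j); apply: (nrw i j k _ _ _ _).2; rewrite ?ij.
  + by apply: (nrw i k j _ _ _ _).1; rewrite ?ik.
rewrite le_max; apply/orP; right; rewrite addrC.
apply: le_trans (scd_le scd (ltnW ki) (ltnW ij) (sn _ sj)) _.
by rewrite lerD2l (scd_sym scd k i) ler_wpM2r.
Qed.

Lemma SRA_free_size (R : realType) (X : metricType R) (alpha : R) :
  SRA_free X alpha -> exists N, forall (f : nat -> X) (s : seq nat),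
    uniq s -> {in s &, injective f} -> SRA alpha (f @` [set` s]) ->
    (size s <= N)%N.
Proof.
move=> [N hN]; exists N => f s us inj sra.
pose g k := f (nth 0%N s k).
have gI : {in `I_(size s) &, injective g}.
  move=> i j; rewrite !inE /= => hi hj /inj; rewrite !mem_nth // => /(_ isT isT).
  by move=> /eqP; rewrite nth_uniq // => /eqP.
have := hN _ sra; rewrite -card_le_II -(card_le_eql (inj_card_eq gI)).
apply: card_le_trans; apply: subset_card_le => _ [i /= hi <-].
by exists (nth 0%N s i) => //=; apply: mem_nth.
Qed.

Theorem theorem1p3 (R : realType) (X : metricType R) (alpha : R)
    (halpha : 2^-1 < alpha < 1) (hX : SRA_free X alpha) :
  exists lambda0 : R, 0 < lambda0 /\
    forall (lambda T : R) (gamma : R -> X),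
      -1 <= lambda < lambda0 -> 0 <= T ->
      rough_self_contracting lambda T gamma ->
      bounded_curve T gamma ->
      rectifiable T gamma.
Proof.
have alpha01 : 0 < alpha < 1 by lra.
have [N hN] := SRA_free_size hX.
have [Q [lam0 [Q0 /andP[lam00 lama] bound]]] := chain_length_bound N alpha01.
exists lam0; split=> // lambda T gamma /andP[_ lamlt] _ rsc [M hM].
(* The absolute value keeps the bound nonnegative, as samples with at most one point require. *)
apply: le_lt_trans (ltry (Q * `|M|)).
apply: ge_ereal_sup => _ [s [srt sT] <-]; rewrite lee_fin.
pose d i j := mdist (gamma s`_i) (gamma s`_j).
rewrite -[polygonal_length _ _]/(chain_length d (size s).-1).
set n := (size s).-1.
have [n0|n0] := posnP n.
  by rewrite n0 /chain_length big_geq // mulr_ge0 // ltW.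
have szs i : (i <= n)%N -> (i < size s)%N.
  by move=> /leq_ltn_trans; apply; rewrite ltn_predL; move: n0; rewrite /n; case: (size s).
have inT i : (i <= n)%N -> s`_i \in `[0, T].
  by move=> /szs ?; apply: sT; apply: mem_nth.
have lt_s i j : (i < j)%N -> (j <= n)%N -> s`_i < s`_j.
  move=> ij /szs jn; apply: (sorted_ltn_nth lt_trans) => //.
  exact: ltn_trans jn.
have le_s i j : (i <= j)%N -> (j <= n)%N -> s`_i <= s`_j.
  rewrite leq_eqVlt => /predU1P[->//|ij jn]; exact/ltW/lt_s.
have inj i j : (i < j <= n)%N -> gamma s`_i != gamma s`_j.
  move=> /andP[ij jn]; apply: contraTneq (lt_s _ _ ij jn).
  by move=> /(rsc_injective rsc)->; rewrite ?ltxx ?inT // (leq_trans (ltnW ij)).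
(* Distances being nonnegative, [lambda] may be raised to [lam0], which also covers negative
   [lambda]. *)
have scd : self_contracting_dist lam0 n d.
  split=> [i|i j|i j k|i j ij|i j k ij jk kn].
  - exact: mdistxx.
  - exact: metric_sym.
  - exact: metric_triangle.
  - by rewrite mdist_gt0 inj.
  have jn := leq_trans jk kn; have lein := leq_trans ij jn.
  apply: le_trans (rsc_le rsc (inT _ lein) (inT _ jn) (inT _ kn) _ _) _.
  - exact: le_s.
  - exact: le_s.
  by rewrite lerD2l ler_wpM2r ?mdist_ge0 // ltW.
apply: le_trans (bound n d _ n0) _; last first.
  rewrite ler_pM2l //; apply: le_trans (ler_norm M).
  by apply: hM; [exists s`_0|exists s`_n] => //=; apply: inT.
split=> // t tsrt tn nrw; apply: (hN (fun i => gamma s`_i)).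
- by rewrite (sorted_uniq ltn_trans ltnn).
- move=> i j ti tj eqg; case: (ltngtP i j) => // [ij|ji].
    by have := inj i j; rewrite ij tn // eqg eqxx => /(_ isT).
  by have := inj j i; rewrite ji tn // eqg eqxx => /(_ isT).
- move=> _ _ _ [i ti <-] [j tj <-] [k tk <-].
  exact: (narrow_SRA (andP alpha01).1 lama scd tn nrw).
Qed.
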